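(* Let $M=M[\mathcal{I}]$ be a multi-path matroid on $S$ of rank $r$ and nullity $m$, presented by an antichain $\mathcal{I}$ of $\sigma$-intervals, and fix $x\in S$. A set $B\subseteq S$ is a basis of $M$ if and only if there is a lattice path $R$ such that (i) $R$ goes from some point $p_i$ to the corresponding point $p'_i$ ($1\le i\le k$), (ii) $R$ uses East and North steps of the diagram $D(\mathcal{I},x)$ (i.e. $R$ stays in its region), and (iii) the labels on the North steps of $R$ are exactly the elements of $B$.
   Context: Transversal matroid $M[\mathcal{A}]$ of a multiset $\mathcal{A}$ of subsets of a finite set $S$: its independent sets are the partial transversals (sets of distinct elements chosen from distinct members, one from each chosen member). For a cyclic permutation $\sigma$ of $S$, a $\sigma$-interval is a nonempty set $I=\{f_I,\sigma(f_I),\ldots,l_I\}$ with first element $f_I$ and last element $l_I$. $\mathcal{I}$ is an antichain (no member contains another) of $r$ $\sigma$-intervals; $|S|=m+r$. The diagram $D(\mathcal{I},x)$: let $k-1$ be the number of intervals $I\in\mathcal{I}$ with $x\in I$ and $x\ne f_I$. For $1\le i\le k$ let $p_i=(k-i,i-1)$ and $p'_i=p_i+(m,r)$; let $L$, $L'$ be the lines of slope $-1$ through the $p_i$, resp. the $p'_i$. Let $P$ be the lattice path from $p_1$ to $p'_1$ whose $t$-th step ($1\le t\le m+r$) is North $(0,1)$ if $\sigma^{t-1}(x)$ is the last element of some interval of $\mathcal{I}$ and East $(1,0)$ otherwise; let $Q$ be the lattice path from $p_k$ to $p'_k$ whose $t$-th step is North if $\sigma^{t-1}(x)$ is the first element of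 some interval of $\mathcal{I}$ and East otherwise ($P$ never goes above $Q$). The region of the diagram is the closed region bounded by $L$, $L'$, $P$, $Q$; its steps (edges) are the unit segments between lattice points lying in it. A step starting at the lattice point $(a,b)$ with $a+b=k-1+(t-1)$ (i.e. the $t$-th step of any lattice path starting on $L$) is labelled $\sigma^{t-1}(x)$. *)

(* Defs.v *)
From mathcomp Require Import all_boot all_fingroup.

Set Implicit Arguments.
Unset Strict Implicit.
Unset Printing Implicit Defensive.

(* The assignment [phi] of members of the family to the elements of [X] is
   option-valued so that [set0] is independent even when the family is empty. *)
Definition partial_transversal (S J : finType) (A : J -> {set S})
    (X : {set S}) : bool :=
  [exists phi : {ffun S -> option J},
     [forall y in X, exists j, (phi y == Some j) && (y \in A j)] &&
     [forall y in X, forall z in X, (phi y == phi z) ==> (y == z)]].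

Definition transversal_basis (S J : finType) (A : J -> {set S})
    (B : {set S}) : bool :=
  maxset (partial_transversal A) B.

Definition antichain (S J : finType) (A : J -> {set S}) : Prop :=
  forall i j : J, i != j -> ~~ (A i \subset A j).

Definition cyclic_perm (S : finType) (s : {perm S}) : Prop :=
  forall a b : S, b \in porbit s a.

(* The interval {a, s a, ..., b}: [findex s a b] is the least [d] with
   [s^d a = b], which exists when [s] is cyclic.  The whole set S is obtained
   for every [a], with [b = s^-1 a]; the end points are therefore kept as data
   instead of being read off the underlying set. *)
Definition sinterval (S : finType) (s : {perm S}) (a b : S) : {set S} :=
  [set y in traject s a (findex s a b).+1].

(* In the rest of the file, a family of r intervals is given by its first and
   last elements [f l : 'I_r -> S]. *)
Definition intervals (S : finType) (s : {perm S}) (r : nat)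
    (f l : 'I_r -> S) : 'I_r -> {set S} :=
  fun j => sinterval s (f j) (l j).

Variant step := East | North.

Definition is_north (d : step) : bool := if d is North then true else false.

Definition point := (nat * nat)%type.

Definition move (p : point) (d : step) : point :=
  match d with East => (p.1.+1, p.2) | North => (p.1, p.2.+1) end.

(* A lattice path is a starting point together with its sequence of steps. *)
Definition path_end (p : point) (w : seq step) : point := foldl move p w.

Fixpoint path_steps (p : point) (w : seq step) : seq (point * step) :=
  if w is d :: w' then (p, d) :: path_steps (move p d) w' else [::].

Definition diag_k (S : finType) (s : {perm S}) (r : nat) (f l : 'I_r -> S)
    (x : S) : nat :=
  #|[set j | (x \in intervals s f l j) && (x != f j)]|.+1.

(* Meant for 1 <= i <= k, where the truncated subtractions are exact. *)
Definition diag_start (k i : nat) : point := (k - i, i - 1).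

Definition diag_end (k m r i : nat) : point :=
  ((diag_start k i).1 + m, (diag_start k i).2 + r).

(* With [g := l] these are the steps of P, with [g := f] those of Q. *)
Definition bound_steps (S : finType) (s : {perm S}) (m r : nat)
    (g : 'I_r -> S) (x : S) : seq step :=
  mkseq (fun t => if [exists j, g j == iter t s x] then North else East)
        (m + r).

(* The lattice points between L and L', on or above P and on or below Q; the
   comparison is made along the line of slope -1 through the point, which P and
   Q both meet after [t] steps. *)
Definition in_region (S : finType) (s : {perm S}) (m r : nat)
    (f l : 'I_r -> S) (x : S) (p : point) : bool :=
  let k := diag_k s f l x in
  let t := p.1 + p.2 - (k - 1) in
  [&& k - 1 <= p.1 + p.2, p.1 + p.2 <= k - 1 + (m + r),
      (path_end (diag_start k 1) (take t (bound_steps s m l x))).2 <= p.2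
    & p.2 <= (path_end (diag_start k k) (take t (bound_steps s m f x))).2].

Definition diag_step (S : finType) (s : {perm S}) (m r : nat)
    (f l : 'I_r -> S) (x : S) (e : point * step) : bool :=
  in_region s m f l x e.1 && in_region s m f l x (move e.1 e.2).

Definition step_label (S : finType) (s : {perm S}) (k : nat) (x : S)
    (e : point * step) : S :=
  iter (e.1.1 + e.1.2 - (k - 1)) s x.

Definition north_labels (S : finType) (s : {perm S}) (k : nat) (x : S)
    (p : point) (w : seq step) : {set S} :=
  [set y in [seq step_label s k x e | e <- path_steps p w & is_north e.2]].

(* Main.v *)
Require Import Defs.
From mathcomp Require Import all_boot all_fingroup zify.

Set Implicit Arguments.
Unset Strict Implicit.
Unset Printing Implicit Defensive.

(* Order [S] by position after [x] along [s]. If [g j] represents the [j]-th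
   interval in a basis [B], comparing the positions of [f j], [g j] and [l j]
   one [j] at a time shows that
   (#l below u) - (#B below u) <= (k - 1) + (#f below t) - (#B below t) for all
   [t] and [u]. The largest left-hand side is then the starting height of a path
   with North steps [B] that lies between P and Q. Conversely, the antichain
   condition makes the cyclic orders of the first and of the last elements agree
   up to a shift by [k - 1], so that the [q]-th North step (from 0) of a path of
   the diagram starting at height [h] is labelled by an element of the interval
   whose last element has rank [h + q] mod [r]. *)

Lemma card_imsetT (S J : finType) (g : J -> S) :
  injective g -> #|g @: [set: J]| = #|J|.
Proof. by move=> g_inj; rewrite card_imset // cardsT. Qed.

Lemma imsetT_inj_eq (S J : finType) (g : J -> S) (B : {set S}) :
    injective g -> (forall j, g j \in B) -> #|B| = #|J| ->
  B = g @: [set: J].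
Proof.
move=> g_inj gB card_B; apply/esym/eqP.
rewrite eqEcard card_imsetT // card_B leqnn andbT.
by apply/subsetP=> _ /imsetP[j _ ->].
Qed.

Section Transversals.

Variables (S J : finType) (A : J -> {set S}).
Implicit Types (X Y B : {set S}) (phi : {ffun S -> option J}).

Definition matching X phi : bool :=
  [forall y in X, exists j, (phi y == Some j) && (y \in A j)] &&
  [forall y in X, forall z in X, (phi y == phi z) ==> (y == z)].

Lemma matchingP X phi :
  reflect ({in X, forall y, exists2 j, phi y = Some j & y \in A j} /\
           {in X &, injective phi})
          (matching X phi).
Proof.
apply: (iffP andP) => -[phiA phi_inj]; split.
- by move=> y /(forall_inP phiA)/existsP[j /andP[/eqP]]; exists j.
- move=> y z /(forall_inP phi_inj)/forall_inP phi_inj_y /phi_inj_y.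
  by move=> /implyP inj /eqP/inj/eqP.
- apply/forall_inP=> y /phiA[j phiy yj]; apply/existsP; exists j.
  by rewrite phiy eqxx.
- apply/forall_inP=> y yX; apply/forall_inP=> z zX; apply/implyP=> /eqP.
  by move/(phi_inj _ _ yX zX)=> ->.
Qed.

Lemma partial_transversalP X :
  reflect (exists phi, matching X phi) (partial_transversal A X).
Proof. exact: existsP. Qed.

Lemma matching_imset_sub X phi :
  matching X phi -> phi @: X \subset Some @: [set: J].
Proof.
case/matchingP=> phiA _; apply/subsetP=> _ /imsetP[y /phiA[j -> _] ->].
by rewrite imset_f.
Qed.

Lemma partial_transversal_card X : partial_transversal A X -> #|X| <= #|J|.
Proof.
case/partial_transversalP=> phi phiX; have [_ phi_inj] := matchingP _ _ phiX.
rewrite -(card_in_imset phi_inj) -(card_imsetT Some_inj).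
exact/subset_leq_card/matching_imset_sub.
Qed.

Definition reassign phi (y : S) (j : J) : {ffun S -> option J} :=
  [ffun z => if z == y then Some j else phi z].

Lemma matching_reassign X phi y j :
    matching X phi -> y \in A j -> Some j \notin phi @: X ->
  matching (y |: X) (reassign phi y j).
Proof.
case/matchingP=> phiA phi_inj yj jfree; apply/matchingP.
have phi_neq z : z \in X -> phi z <> Some j.
  by move=> zX phiz; case/negP: jfree; rewrite -phiz imset_f.
split=> [z|z z']; rewrite !inE !ffunE.
  by case: eqP => [-> _|_ /= /phiA //]; exists j.
case: eqP => [->|_]; case: eqP => [->|_] //= zX zX'.
- by move=> /esym/(phi_neq _ zX').
- by move=> /(phi_neq _ zX).
- exact: phi_inj.
Qed.

(* Among the matchings of [X], take one that agrees with a matching [psi] of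
   [Y] as often as possible. Some [y] in [Y] has its member [psi y] unused by
   [X]; were [y] in [X], reassigning it to [psi y] would increase the
   agreement. *)
Lemma partial_transversal_augment X Y :
    partial_transversal A X -> partial_transversal A Y -> #|X| < #|Y| ->
  exists2 y, y \in Y :\: X & partial_transversal A (y |: X).
Proof.
move=> /partial_transversalP[phi0 phi0X] /partial_transversalP[psi psiY] ltXY.
have [psiA psi_inj] := matchingP _ _ psiY.
pose agreement phi := [set y in X :&: Y | phi y == psi y].
have [phi phiX phi_max] := arg_maxnP (fun phi => #|agreement phi|) phi0X.
have [_ phi_inj] := matchingP _ _ phiX.
have /subsetPn[_ /imsetP[y yY ->]] : ~~ (psi @: Y \subset phi @: X).
  by apply: contraL ltXY => /subset_leq_card; rewrite !card_in_imset // -leqNgt.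
have [j psiy yj] := psiA y yY; rewrite psiy => jfree.
have chiX := matching_reassign phiX yj jfree.
exists y; last by apply/partial_transversalP; exists (reassign phi y j).
rewrite inE yY andbT; apply/negP=> yX.
have yX_X : y |: X = X by apply/setUidPr; rewrite sub1set.
rewrite yX_X in chiX; have := phi_max _ chiX; apply/negP; rewrite -ltnNge.
apply/proper_card/properP; split.
  apply/subsetP=> z; rewrite !inE ffunE => /andP[-> /= agree].
  by case: (z =P y) => [->|//]; rewrite psiy.
exists y; rewrite !inE ?ffunE yX yY psiy ?eqxx //=.
by apply: contra jfree => /eqP <-; rewrite imset_f.
Qed.

Definition distinct_representatives (g : J -> S) : Prop :=
  injective g /\ forall j, g j \in A j.

Lemma distinct_representatives_partial_transversal g :
  distinct_representatives g -> partial_transversal A (g @: [set: J]).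
Proof.
case=> g_inj gA; apply/partial_transversalP.
pose phi := [ffun y => [pick j | g j == y]]; exists phi.
have phig j : phi (g j) = Some j.
  rewrite ffunE; case: pickP => [i /eqP/g_inj -> //|/(_ j)].
  by rewrite eqxx.
apply/matchingP; split=> [_ /imsetP[j _ ->]|].
  by exists j; rewrite ?phig.
move=> _ _ /imsetP[i _ ->] /imsetP[j _ ->].
by rewrite !phig => -[->].
Qed.

Lemma full_partial_transversal_representatives B :
    partial_transversal A B -> #|B| = #|J| ->
  exists2 g, distinct_representatives g & B = g @: [set: J].
Proof.
case/partial_transversalP=> phi phiB card_B.
have [phiA phi_inj] := matchingP _ _ phiB.
have phi_onto : phi @: B = Some @: [set: J].
  apply/eqP; rewrite eqEcard matching_imset_sub //=.
  by rewrite (card_in_imset phi_inj) (card_imsetT Some_inj) card_B.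
have /fin_all_exists2[g gB phig] j : exists2 y, y \in B & phi y = Some j.
  have : Some j \in phi @: B by rewrite phi_onto imset_f.
  by case/imsetP=> y yB phiy; exists y.
have g_inj : injective g.
  by move=> i j gij; apply: Some_inj; rewrite -!phig gij.
exists g; first split=> // j.
  by have [i] := phiA _ (gB j); rewrite phig => -[<-].
exact: imsetT_inj_eq.
Qed.

Lemma transversal_basisP f B :
    distinct_representatives f ->
  reflect (exists2 g, distinct_representatives g & B = g @: [set: J])
          (transversal_basis A B).
Proof.
move=> f_repr; have card_repr g : distinct_representatives g ->
  #|g @: [set: J]| = #|J| by case=> /card_imsetT.
apply: (iffP maxsetP) => [[ptB maxB]|[g g_repr ->]].
  apply: full_partial_transversal_representatives => //.
  apply/eqP; rewrite eqn_leq partial_transversal_card //=.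
  rewrite leqNgt -(card_repr f) //.
  have ptf := distinct_representatives_partial_transversal f_repr.
  apply/negP=> /(partial_transversal_augment ptB ptf)[y /setDP[_ yB] /maxB].
  by move=> yB_B; rewrite -yB_B ?setU11 ?subsetUr in yB.
split=> [|C ptC sgC]; first exact: distinct_representatives_partial_transversal.
by apply/esym/eqP; rewrite eqEcard sgC card_repr // partial_transversal_card.
Qed.

End Transversals.

Section CyclicOrder.

Variables (S : finType) (s : {perm S}).
Hypothesis s_cyclic : cyclic_perm s.

Lemma cyclic_fconnect a b : fconnect s a b.
Proof. by have /porbitP[i ->] := s_cyclic a b; rewrite permX fconnect_iter. Qed.

Lemma cyclic_order a : fingraph.order s a = #|S|.
Proof. by apply: eq_card => b; rewrite !inE cyclic_fconnect. Qed.

Lemma cyclic_iter_findex a b : iter (findex s a b) s a = b.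
Proof. exact/iter_findex/cyclic_fconnect. Qed.

Lemma cyclic_findex_lt a b : findex s a b < #|S|.
Proof. by rewrite -(cyclic_order a) findex_max // cyclic_fconnect. Qed.

Lemma cyclic_findex_iter a t : t < #|S| -> findex s a (iter t s a) = t.
Proof. by move=> tS; rewrite findex_iter // cyclic_order. Qed.

Lemma cyclic_findex_inj a : injective (findex s a).
Proof.
by move=> b c bc; rewrite -(cyclic_iter_findex a b) bc cyclic_iter_findex.
Qed.

Lemma cyclic_findex_rebase x a y :
  findex s a y =
    if findex s x a <= findex s x y then findex s x y - findex s x a
    else findex s x y + #|S| - findex s x a.
Proof.
have lt_y := cyclic_findex_lt x y; have lt_a := cyclic_findex_lt x a.
have iter_a d : findex s x a <= d -> iter (d - findex s x a) s a = iter d s x.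
  by move=> /subnK {2}<-; rewrite iterD cyclic_iter_findex.
case: leqP => [le_ay|lt_ya].
  by rewrite -{1}(cyclic_iter_findex x y) -iter_a ?cyclic_findex_iter //; lia.
have {1}-> : y = iter (findex s x y + #|S| - findex s x a) s a.
  rewrite iter_a; last by lia.
  rewrite iterD -(cyclic_order x) iter_order ?cyclic_iter_findex //.
  exact: perm_inj.
by rewrite cyclic_findex_iter //; lia.
Qed.

Variable x : S.
Implicit Types X : {set S}.

Definition wraps (a b : S) : bool := findex s x b < findex s x a.

Lemma mem_sinterval a b y :
  (y \in sinterval s a b) =
    if wraps a b then
      (findex s x a <= findex s x y) || (findex s x y <= findex s x b)
    else findex s x a <= findex s x y <= findex s x b.
Proof.
have -> : (y \in sinterval s a b) = (findex s a y <= findex s a b).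
  rewrite inE; apply/trajectP/idP => [[i lt_ib ->]|le_yb].
    by rewrite cyclic_findex_iter // (leq_trans lt_ib) // cyclic_findex_lt.
  by exists (findex s a y); rewrite ?cyclic_iter_findex.
rewrite !(cyclic_findex_rebase x a) /wraps.
have lt_a := cyclic_findex_lt x a; have lt_b := cyclic_findex_lt x b.
have lt_y := cyclic_findex_lt x y.
by case: (leqP (findex s x a) (findex s x y));
  case: (leqP (findex s x a) (findex s x b)); lia.
Qed.

Lemma wrapsE a b : wraps a b = (x \in sinterval s a b) && (x != a).
Proof.
rewrite mem_sinterval findex0 -(inj_eq (@cyclic_findex_inj x)) findex0 /wraps.
by case: ltnP; lia.
Qed.

Lemma sinterval_sub_same_wraps a b a' b' :
    wraps a b = wraps a' b' -> findex s x a' <= findex s x a ->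
    findex s x b <= findex s x b' ->
  sinterval s a b \subset sinterval s a' b'.
Proof.
move=> eq_wraps le_a le_b; apply/subsetP=> y; rewrite !mem_sinterval eq_wraps.
case: (wraps a' b'); lia.
Qed.

Lemma sinterval_sub_mixed_wraps a b a' b' :
    ~~ wraps a b -> wraps a' b' ->
    (findex s x a' <= findex s x a) || (findex s x b <= findex s x b') ->
  sinterval s a b \subset sinterval s a' b'.
Proof.
move=> /negPf nwraps wraps' le_ab; apply/subsetP=> y.
rewrite !mem_sinterval nwraps wraps'; lia.
Qed.

Lemma sinterval_exchange a b y t u : y \in sinterval s a b ->
  (findex s x b < u) + (findex s x y < t) <=
    wraps a b + (findex s x a < t) + (findex s x y < u).
Proof. by rewrite mem_sinterval /wraps; case: ltnP; lia. Qed.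

Definition count_before X (t : nat) : nat :=
  #|[set y in X | findex s x y < t]|.

Lemma count_before0 X : count_before X 0 = 0.
Proof. by apply: eq_card0 => y; rewrite !inE ltn0 andbF. Qed.

Lemma count_beforeS X t : t < #|S| ->
  count_before X t.+1 = count_before X t + (iter t s x \in X).
Proof.
move=> tS; set y := iter t s x.
have ltS z : (findex s x z < t.+1) = (z == y) || (findex s x z < t).
  rewrite ltnS leq_eqVlt -(inj_eq (@cyclic_findex_inj x)).
  by rewrite [findex s x y]cyclic_findex_iter.
have [yX|yX] := boolP (y \in X); last first.
  rewrite addn0; apply: eq_card => z; rewrite !inE ltS.
  by case: eqP => [->|]; rewrite ?(negPf yX).
have := cardsU1 y [set z in X | findex s x z < t].
rewrite inE cyclic_findex_iter // ltnn andbF addnC => <-.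
apply: eq_card => z; rewrite !inE ltS.
by case: eqP => [->|]; rewrite ?yX.
Qed.

Lemma count_before_card X : count_before X #|S| = #|X|.
Proof. by apply: eq_card => y; rewrite !inE cyclic_findex_lt andbT. Qed.

Lemma count_before_le X t u : t <= u -> count_before X t <= count_before X u.
Proof.
move=> le_tu; apply/subset_leq_card/subsetP=> y; rewrite !inE.
by case/andP=> -> /leq_trans; apply.
Qed.

Lemma count_before_ltE X y u : y \in X ->
  (count_before X (findex s x y) < count_before X u) = (findex s x y < u).
Proof.
move=> yX; case: (ltnP (findex s x y) u) => [lt_yu|le_uy]; last first.
  by apply/negbTE; rewrite -leqNgt count_before_le.
apply/proper_card/properP; split; last by exists y; rewrite !inE yX ?ltnn.
by apply/subsetP=> z; rewrite !inE => /andP[-> /ltn_trans]; apply.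
Qed.

Lemma count_before_inj X :
  {in X &, injective (fun y => count_before X (findex s x y))}.
Proof.
move=> y z yX zX eq_yz; apply: (@cyclic_findex_inj x).
have := count_before_ltE (findex s x z) yX.
have := count_before_ltE (findex s x y) zX.
by rewrite eq_yz ltnn; lia.
Qed.

Lemma count_before_lt_card X y :
  y \in X -> count_before X (findex s x y) < #|X|.
Proof.
move=> yX; rewrite -(count_before_card X) count_before_ltE //.
exact: cyclic_findex_lt.
Qed.

Lemma count_before_onto X q : q < #|X| ->
  exists2 y, y \in X & count_before X (findex s x y) = q.
Proof.
move=> ltq; have ex_t : exists t, q < count_before X t.
  by exists #|S|; rewrite count_before_card.
have [[|t] lt_q min_t] := ex_minnP ex_t; first by rewrite count_before0 in lt_q.
have tS : t < #|S| by apply: min_t; rewrite count_before_card.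
have le_q : count_before X t <= q.
  by rewrite leqNgt; apply/negP=> /min_t; rewrite ltnn.
rewrite count_beforeS // in lt_q; exists (iter t s x).
  by case: (iter t s x \in X) lt_q => //; lia.
rewrite cyclic_findex_iter //; case: (iter t s x \in X) lt_q; lia.
Qed.

Lemma count_before_imset (J : finType) (g : J -> S) t : injective g ->
  count_before (g @: [set: J]) t = \sum_j (findex s x (g j) < t).
Proof.
move=> g_inj; rewrite -big_mkcond sum1dep_card.
rewrite /count_before -(card_imset _ g_inj).
apply: eq_card => y; rewrite !inE; apply/andP/imsetP.
  by case=> /imsetP[j _ ->] lt; exists j; rewrite ?inE.
by case=> j; rewrite inE => lt ->; rewrite imset_f.
Qed.

End CyclicOrder.

Lemma separating_shift (n : nat) (L G U : nat -> nat) :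
    (forall t u, t <= n -> u <= n -> L u + G t <= U t + G u) -> G 0 = 0 ->
  exists h, forall t, t <= n -> L t <= h + G t <= U t.
Proof.
move=> exchange G0; pose deficit (u : 'I_n.+1) := L u - G u.
exists (\max_u deficit u) => t tn; apply/andP; split.
  have : deficit (inord t) <= \max_u deficit u by apply: leq_bigmax.
  by rewrite /deficit inordK // leq_subLR addnC.
have le_GU : G t <= U t by have := exchange t 0 tn isT; rewrite G0; lia.
rewrite addnC -leq_subRL //; apply/bigmax_leqP => u _.
by have := exchange t u tn (leq_ord u); rewrite /deficit; lia.
Qed.

Section IntervalFamily.

Variables (S : finType) (s : {perm S}) (r : nat) (f l : 'I_r -> S) (x : S).
Hypothesis s_cyclic : cyclic_perm s.

Local Notation pos := (findex s x).
Local Notation before := (count_before s x).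
Local Notation wrap j := (wraps s x (f j) (l j)).
Local Notation firsts := (f @: [set: 'I_r]).
Local Notation lasts := (l @: [set: 'I_r]).

Definition wrap_count : nat := \sum_j wrap j.

Lemma diag_kE : diag_k s f l x = wrap_count.+1.
Proof.
rewrite /wrap_count -big_mkcond sum1dep_card; congr _.+1.
by apply: eq_card => j; rewrite !inE (wrapsE s_cyclic) inE.
Qed.

Lemma wrap_count_le : wrap_count <= r.
Proof.
rewrite -[leqRHS]card_ord -sum1_card; apply: leq_sum => j _.
exact: leq_b1.
Qed.

(* The path with North steps [B] starting on L at height [h] stays between P and
   Q; the latter starts at height [wrap_count], which is [k - 1]. *)
Definition between_bounds (h : nat) (B : {set S}) : Prop :=
  forall t, t <= #|S| ->
    before lasts t <= h + before B t <= wrap_count + before firsts t.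

Lemma between_bounds_le_wrap_count h B : between_bounds h B -> h <= wrap_count.
Proof. by move=> /(_ 0 isT) /andP[_]; rewrite !count_before0 !addn0. Qed.

Lemma first_mem_intervals j : f j \in intervals s f l j.
Proof. by rewrite inE trajectS mem_head. Qed.

Hypothesis antichain_fl : antichain (intervals s f l).

Lemma antichain_same_wraps i j :
    i != j -> wrap i = wrap j -> pos (f j) <= pos (f i) ->
  pos (l j) < pos (l i).
Proof.
move=> ij eq_wrap le_f; rewrite ltnNge; apply: contra (antichain_fl ij).
exact: sinterval_sub_same_wraps.
Qed.

Lemma antichain_mixed_wraps i j :
    ~~ wrap i -> wrap j -> pos (f i) < pos (f j) /\ pos (l j) < pos (l i).
Proof.
move=> nwrap_i wrap_j; have ij : i != j.
  by apply: contraNneq nwrap_i => ->.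
apply/andP; rewrite !ltnNge -negb_or; apply: contra (antichain_fl ij).
exact: sinterval_sub_mixed_wraps.
Qed.

Lemma antichain_endpoints i j : i != j ->
  [/\ pos (f i) != pos (f j), pos (l i) != pos (l j)
    & (pos (f i) < pos (f j)) + wrap i = (pos (l i) < pos (l j)) + wrap j].
Proof.
move=> ij; have ji : j != i by rewrite eq_sym.
move: (antichain_same_wraps ij) (antichain_same_wraps ji).
move: (@antichain_mixed_wraps i j) (@antichain_mixed_wraps j i).
by case: (wrap i); case: (wrap j) => *; split; lia.
Qed.

Lemma antichain_first_inj : injective f.
Proof.
move=> i j fij; apply/eqP/negPn/negP=> /antichain_endpoints[].
by rewrite fij eqxx.
Qed.

Lemma antichain_last_inj : injective l.
Proof.
move=> i j lij; apply/eqP/negPn/negP=> /antichain_endpoints[_].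
by rewrite lij eqxx.
Qed.

Lemma count_first_last j :
  before firsts (pos (f j)) + wrap_count =
  before lasts (pos (l j)) + (if wrap j then r else 0).
Proof.
rewrite !count_before_imset;
  [|exact: antichain_last_inj|exact: antichain_first_inj].
have -> : (if wrap j then r else 0) = \sum_(i < r) wrap j.
  by rewrite sum_nat_const card_ord; case: (wrap j); rewrite ?muln1 ?muln0.
rewrite -!big_split; apply: eq_bigr => i _ /=.
by have [->|/antichain_endpoints[]//] := eqVneq i j; rewrite !ltnn.
Qed.

Lemma mem_intervals_rank h B j y :
    between_bounds h B -> y \in B ->
    h + before B (pos y) = before lasts (pos (l j)) \/
      h + before B (pos y) = before lasts (pos (l j)) + r ->
  y \in intervals s f l j.
Proof.
move=> between_hB yB rank_y; have yS := cyclic_findex_lt s_cyclic x y.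
have /andP[lower _] := between_hB _ (ltnW yS).
have /andP[_ upper] := between_hB _ yS.
rewrite count_beforeS // cyclic_iter_findex // yB in upper.
have last_lasts : l j \in lasts by rewrite imset_f.
have first_firsts : f j \in firsts by rewrite imset_f.
have last_ge : before lasts (pos y) <= before lasts (pos (l j)) ->
    pos y <= pos (l j).
  by rewrite leqNgt count_before_ltE // -leqNgt.
have first_le : before firsts (pos (f j)) < before firsts (pos y).+1 ->
    pos (f j) <= pos y.
  by rewrite count_before_ltE.
(* If the interval wraps, one of [last_ge] and [first_le] suffices; otherwise
   [count_first_last] excludes the second case of [rank_y] and both apply. *)
have := count_first_last j; have := wrap_count_le.
have := count_before_lt_card s_cyclic x last_lasts.
have := count_before_le s x firsts yS; rewrite count_before_card //.
rewrite (card_imsetT antichain_first_inj) (card_imsetT antichain_last_inj).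
rewrite card_ord.
rewrite (mem_sinterval s_cyclic x); case: (wrap j); lia.
Qed.

Lemma between_bounds_representatives h B :
    between_bounds h B -> #|B| = r ->
  exists2 g, distinct_representatives (intervals s f l) g &
             B = g @: [set: 'I_r].
Proof.
move=> between_hB card_B.
have h_le_r : h <= r.
  exact: leq_trans (between_bounds_le_wrap_count between_hB) wrap_count_le.
pose rank j := before lasts (pos (l j)).
have rank_lt j : rank j < r.
  rewrite -[r in _ < r]card_ord -(card_imsetT antichain_last_inj).
  by rewrite count_before_lt_card // imset_f.
have rank_inj : injective rank.
  move=> i j eq_rank; apply: antichain_last_inj.
  apply: (count_before_inj s_cyclic (X := lasts) _ _ eq_rank);
    by rewrite imset_f.
pose rankB j := if h <= rank j then rank j - h else rank j + r - h.
have rankB_lt j : rankB j < #|B|.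
  by rewrite card_B /rankB; have := rank_lt j; case: ifP; lia.
have /fin_all_exists2[g gB g_rank] j :=
  count_before_onto s_cyclic x (rankB_lt j).
have g_inj : injective g.
  move=> i j gij; apply: rank_inj; have := rank_lt i; have := rank_lt j.
  have : rankB i = rankB j by rewrite -!g_rank gij.
  by rewrite /rankB; do 2!case: ifP; lia.
exists g; last by apply: imsetT_inj_eq; rewrite ?card_ord.
split=> // j; apply: mem_intervals_rank between_hB (gB j) _; rewrite g_rank.
by have := rank_lt j; rewrite -/(rank j) /rankB; case: ifP; lia.
Qed.

Lemma representatives_between_bounds g :
    distinct_representatives (intervals s f l) g ->
  exists h, between_bounds h (g @: [set: 'I_r]).
Proof.
case=> g_inj g_mem; apply: separating_shift; last exact: count_before0.
move=> t u _ _; rewrite !count_before_imset //;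
  [|exact: antichain_first_inj|exact: antichain_last_inj].
rewrite /wrap_count -!big_split; apply: leq_sum => j _ /=.
exact: sinterval_exchange.
Qed.

Lemma transversal_basis_between_bounds B :
  transversal_basis (intervals s f l) B <->
  #|B| = r /\ exists h, between_bounds h B.
Proof.
have f_repr : distinct_representatives (intervals s f l) f.
  by split=> [|j]; [exact: antichain_first_inj|exact: first_mem_intervals].
split=> [/(transversal_basisP _ f_repr)[g g_repr ->]|[card_B [h between_hB]]].
  split; last exact: representatives_between_bounds.
  by case: g_repr => /card_imsetT-> _; rewrite card_ord.
apply/(transversal_basisP _ f_repr).
exact: between_bounds_representatives between_hB card_B.
Qed.

End IntervalFamily.

Lemma path_endE (p : point) (w : seq step) :
  path_end p w = (p.1 + (size w - count is_north w), p.2 + count is_north w).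
Proof.
elim: w p => [|d w IHw] p /=; first by rewrite !addn0 -surjective_pairing.
have := count_size is_north w; rewrite -[LHS]/(path_end (move p d) w) IHw.
by case: d => /= le_size; congr pair; lia.
Qed.

Lemma path_end_translationP (p : point) (w : seq step) (m r : nat) :
  path_end p w = (p.1 + m, p.2 + r) <-> size w = m + r /\ count is_north w = r.
Proof.
have := count_size is_north w; rewrite path_endE => le_size.
by split=> [[]|[]] => [|-> ->]; [lia|rewrite addnK].
Qed.

Lemma path_stepsE (p : point) (w : seq step) :
  path_steps p w =
  mkseq (fun t => (path_end p (take t w), nth East w t)) (size w).
Proof.
elim: w p => [|d w IHw] p //=.
by rewrite IHw /mkseq /= -[1]addn0 iotaDl -map_comp.
Qed.

Lemma all_path_stepsP (R : pred point) (p : point) (w : seq step) :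
    0 < size w ->
  reflect (forall t, t <= size w -> R (path_end p (take t w)))
          (all (fun e => R e.1 && R (move e.1 e.2)) (path_steps p w)).
Proof.
elim: w p => // d w IHw p _; rewrite /= -andbA.
apply: (iffP and3P) => [[Rp Rp' all_w] [//|t] le_t|R_w].
  case: w IHw all_w le_t => [|d' w] IHw all_w le_t; first by case: t le_t.
  exact: (IHw _ isT all_w).
split; [exact: (R_w 0)|by have := R_w 1 isT; rewrite /= take0|].
case: w IHw R_w => // d' w IHw R_w; apply/IHw=> // t le_t.
exact: (R_w t.+1).
Qed.

Section LatticePaths.

Variables (S : finType) (s : {perm S}) (x : S).
Hypothesis s_cyclic : cyclic_perm s.

Definition north_word (X : {set S}) : seq step :=
  mkseq (fun t => if iter t s x \in X then North else East) #|S|.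

Lemma size_north_word X : size (north_word X) = #|S|.
Proof. exact: size_mkseq. Qed.

Lemma count_north_take X t : t <= #|S| ->
  count is_north (take t (north_word X)) = count_before s x X t.
Proof.
elim: t => [|t IHt] tS; first by rewrite take0 count_before0.
rewrite (take_nth East) ?size_north_word // -cats1 count_cat IHt 1?ltnW //.
by rewrite count_beforeS // nth_mkseq //=; case: (_ \in X).
Qed.

Lemma count_north_word X : count is_north (north_word X) = #|X|.
Proof.
rewrite -(count_before_card s_cyclic x) -count_north_take //.
by rewrite -(size_north_word X) take_size.
Qed.

Lemma bound_stepsE m r (g : 'I_r -> S) :
  #|S| = m + r -> bound_steps s m g x = north_word (g @: [set: 'I_r]).
Proof.
move=> card_S; rewrite /bound_steps /north_word card_S; apply: eq_mkseq => t.
congr (if _ then _ else _); apply/existsP/imsetP => [[j /eqP <-]|[j _ ->]];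
  by exists j.
Qed.

Lemma north_labelsE k (p : point) (w : seq step) :
    p.1 + p.2 = k - 1 -> size w = #|S| ->
  north_labels s k x p w = [set y | is_north (nth East w (findex s x y))].
Proof.
move=> p_on_L size_w; apply/setP=> y; rewrite !inE path_stepsE size_w.
have labelE t : t < #|S| ->
    step_label s k x (path_end p (take t w), nth East w t) = iter t s x.
  move=> tS; rewrite /step_label path_endE /=; congr (iter _ s x).
  have := count_size is_north (take t w); rewrite size_takel; lia.
rewrite filter_map -map_comp; apply/mapP/idP => [[t]|y_north].
  rewrite mem_filter mem_iota /= => /andP[t_north tS] ->.
  by rewrite labelE // cyclic_findex_iter.
have yS := cyclic_findex_lt s_cyclic x y.
exists (findex s x y); last by rewrite /= labelE // cyclic_iter_findex.
by rewrite mem_filter mem_iota /= y_north.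
Qed.

Lemma north_labels_eqP k (p : point) (w : seq step) (B : {set S}) :
    p.1 + p.2 = k - 1 -> size w = #|S| ->
  north_labels s k x p w = B <-> w = north_word B.
Proof.
move=> p_on_L size_w; rewrite north_labelsE //; split=> [<-|->].
  apply: (@eq_from_nth _ East) => [|t]; first by rewrite size_north_word.
  rewrite size_w => tS.
  by rewrite nth_mkseq // inE cyclic_findex_iter //; case: (nth _ w t).
apply/setP=> y; rewrite inE nth_mkseq ?cyclic_findex_lt //.
by rewrite cyclic_iter_findex //; case: (y \in B).
Qed.

Variables (m r : nat) (f l : 'I_r -> S).
Hypothesis card_S : #|S| = m + r.
Let k := diag_k s f l x.

Lemma in_region_north_word (p : point) (B : {set S}) (t : nat) :
    p.1 + p.2 = k - 1 -> t <= #|S| ->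
  in_region s m f l x (path_end p (take t (north_word B))) =
  (count_before s x (l @: [set: 'I_r]) t <= p.2 + count_before s x B t
     <= wrap_count s f l x + count_before s x (f @: [set: 'I_r]) t).
Proof.
move=> p_on_L tS; rewrite /in_region -/k !bound_stepsE // !path_endE.
rewrite size_takel ?size_north_word // count_north_take //=.
have le_Bt : count_before s x B t <= t.
  rewrite -count_north_take // (leq_trans (count_size _ _)) //.
  by rewrite size_takel ?size_north_word.
have -> : p.1 + (t - count_before s x B t) + (p.2 + count_before s x B t) =
    k - 1 + t by lia.
rewrite leq_addr leq_add2l -card_S tS addKn !count_north_take //.
by rewrite subnn /k diag_kE // subn1.
Qed.

Lemma diag_steps_north_wordP (p : point) (B : {set S}) :
    p.1 + p.2 = k - 1 ->
  all (diag_step s m f l x) (path_steps p (north_word B)) <->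
  between_bounds s f l x p.2 B.
Proof.
move=> p_on_L; have word_gt0 : 0 < size (north_word B).
  by rewrite size_north_word; apply/card_gt0P; exists x.
have regionP := all_path_stepsP (in_region s m f l x) p word_gt0.
rewrite size_north_word in regionP.
split=> [/regionP region t tS|between_pB].
  by have := region t tS; rewrite in_region_north_word.
by apply/regionP=> t tS; rewrite in_region_north_word //; apply: between_pB.
Qed.

Lemma diagram_pathP (p : point) (w : seq step) (B : {set S}) :
    p.1 + p.2 = k - 1 ->
  [/\ path_end p w = (p.1 + m, p.2 + r),
      all (diag_step s m f l x) (path_steps p w) & north_labels s k x p w = B]
  <-> [/\ w = north_word B, #|B| = r & between_bounds s f l x p.2 B].
Proof.
move=> p_on_L; split.
  case=> /path_end_translationP[size_w count_w] steps_w labels_w.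
  rewrite -card_S in size_w.
  have w_eq := (north_labels_eqP B p_on_L size_w).1 labels_w.
  rewrite w_eq count_north_word in count_w steps_w *; split=> //.
  exact/diag_steps_north_wordP.
case=> -> card_B between_pB; split.
- by apply/path_end_translationP; rewrite size_north_word count_north_word.
- exact/diag_steps_north_wordP.
- by apply/north_labels_eqP; rewrite ?size_north_word.
Qed.

End LatticePaths.

Lemma diag_start_on_line (k i : nat) :
  1 <= i <= k -> (diag_start k i).1 + (diag_start k i).2 = k - 1.
Proof. by rewrite /=; lia. Qed.

Theorem theorem3p6 (S : finType) (s : {perm S}) (m r : nat)
    (f l : 'I_r -> S) (x : S) (B : {set S}) :
  cyclic_perm s ->
  antichain (intervals s f l) ->
  #|S| = m + r ->
  let k := diag_k s f l x in
  transversal_basis (intervals s f l) B <->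
  exists (i : nat) (w : seq step),
    [/\ 1 <= i <= k,
        path_end (diag_start k i) w = diag_end k m r i,
        all (diag_step s m f l x) (path_steps (diag_start k i) w)
      & north_labels s k x (diag_start k i) w = B].
Proof.
move=> s_cyclic antichain_fl card_S k.
rewrite (transversal_basis_between_bounds x) //; split.
  case=> card_B [h between_hB]; have h_range : 1 <= h.+1 <= k.
    by rewrite /k diag_kE // !ltnS (between_bounds_le_wrap_count between_hB).
  exists h.+1, (north_word s x B).
  have [_ bounds_to_path] := diagram_pathP s_cyclic card_S (north_word s x B) B
    (diag_start_on_line h_range).
  have [|end_w steps_w labels_w] := bounds_to_path; last by split.
  by rewrite /= subn1.
case=> i [w [i_range end_w steps_w labels_w]].
have [path_to_bounds _] := diagram_pathP s_cyclic card_S w B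
  (diag_start_on_line i_range).
have [|_ card_B between_B] := path_to_bounds; first by split.
by split; last exists (i - 1).
Qed.
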